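(* Let $\{M_i\}_{i\in I}$ be a finite set of positive $d\times d$ matrices, and let $\widehat{M}_i$ be the induced map of $M_i$ on $C_+^{d-1}$. Then there exists a bounded and connected open set $U\subset C_+^{d-1}$ such that for each $i\in I$, $\widehat{M}_i|_U$ maps $U$ strictly inside $U$ and each $\widehat{M}_i|_U$ is a complex analytic function. Moreover, $U$ can be chosen such that, for each $i \in I$, $\widehat{M}_i|_V$ maps $V\subset R_+^{d-1}$ strictly inside $V$ as a real analytic map, where $V=\operatorname{Re} U$ is a connected open set.
   Context: Let $d\ge 2$. A matrix is positive if all its entries are strictly positive. Put $C_+^{d-1}=\{z=(1,z_2,\dots,z_d): z_i\in\mathbb{C},\ \operatorname{Re} z_i>0 \text{ for } 2\le i\le d\}$ and $R_+^{d-1}=\{x=(1,x_2,\dots,x_d): x_i\in\mathbb{R},\ x_i>0\text{ for }2\le i\le d\}$; these are identified with open subsets of $\mathbb{C}^{d-1}$ and $\mathbb{R}^{d-1}$ respectively by dropping the first coordinate (openness, analyticity and closures refer to this identification). For a positive matrix $M$, the induced map is $\widehat{M}(z)=Mz/(Mz)_1$, where $(Mz)_1$ is the first entry of $Mz$ (nonzero, since its real part is positive); it maps points $z$ with first coordinate $1$ to points with first coordinate $1$. A map $\psi$ maps an open set $W_1$ strictly inside an open set $W_2$ if $\overline{\psi(W_1)}\subseteq W_2$. $\operatorname{Re} U=\{\operatorname{Re} z: z\in U\}$. Connected open sets are understood to be nonempty. *)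

(* Defs.v *)
From HB Require Import structures.
From mathcomp Require Import all_boot all_order all_algebra.
From mathcomp Require Export complex.
From mathcomp Require Export all_classical all_reals topology normedtype.

Set Implicit Arguments.
Unset Strict Implicit.
Unset Printing Implicit Defensive.

Import Order.TTheory GRing.Theory Num.Theory.
Import numFieldNormedType.Exports.

Local Open Scope classical_set_scope.
Local Open Scope ring_scope.

Definition positive_mx (R : numDomainType) (m n : nat) (M : 'M[R]_(m, n)) :
  Prop := forall i j, 0 < M i j.

(* Throughout d = n.+1, so that K^(d-1) is 'cV[K]_n.  The point
   (1, z_2, ..., z_d) of K^d is identified with (z_2, ..., z_d) by the two
   maps below. *)
Definition add_one (K : pzRingType) (n : nat) (z : 'cV[K]_n) : 'cV[K]_n.+1 :=
  col_mx (1%:M : 'cV[K]_1) z.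

Definition drop_first (K : pzRingType) (n : nat) (w : 'cV[K]_n.+1) : 'cV[K]_n :=
  @dsubmx K 1 n 1 w.

Definition projective_map (K : fieldType) (n : nat) (M : 'M[K]_n.+1)
    (w : 'cV[K]_n.+1) : 'cV[K]_n.+1 :=
  ((M *m w) ord0 ord0)^-1 *: (M *m w).

(* The induced map, read in the coordinates of K^(d-1). *)
Definition induced_map (K : fieldType) (n : nat) (M : 'M[K]_n.+1)
    (z : 'cV[K]_n) : 'cV[K]_n :=
  drop_first (projective_map M (add_one z)).

(* R[i] as a numFieldType: written this way, matrices over it inherit the
   normed and topological structures of matrices over a numFieldType. *)
Definition Cx (R : realType) : numFieldType := R[i].

Definition complexify_mx (R : realType) (m n : nat) (M : 'M[R]_(m, n)) :
  'M[Cx R]_(m, n) := map_mx (real_complex R) M.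

Definition Re_mx (R : realType) (m n : nat) (M : 'M[Cx R]_(m, n)) :
  'M[R]_(m, n) := map_mx (@complex.Re R) M.

Definition C_plus (R : realType) (n : nat) : set 'cV[Cx R]_n :=
  [set z | forall i, 0 < @complex.Re R (z i ord0)].

Definition R_plus (R : realType) (n : nat) : set 'cV[R]_n :=
  [set x | forall i, 0 < x i ord0].

Definition maps_strictly_inside (S T : topologicalType) (psi : S -> T)
    (W1 : set S) (W2 : set T) : Prop :=
  closure (psi @` W1) `<=` W2.

Definition power_term (K : comPzRingType) (n : nat) (c : ('I_n -> nat) -> K)
    (h : 'cV[K]_n) (m : 'I_n -> nat) : K :=
  c m * \prod_(i < n) h i ord0 ^+ m i.

(* f is, on a polydisc around a, the sum of an absolutely convergent power
   series \sum_m c_m h^m over the multi-indices m in nat^n.  As the family is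
   absolutely summable, its sum is the limit of the partial sums over the boxes
   {0, ..., N-1}^n.  Norms take their values in K, also when K is a field of
   complex numbers; 0 < r forces r to be real. *)
Definition analytic_at (K : numFieldType) (n : nat) (f : 'cV[K]_n -> K)
    (a : 'cV[K]_n) : Prop :=
  exists c : ('I_n -> nat) -> K, exists2 r : K, 0 < r &
    forall h : 'cV[K]_n, `|h| < r ->
      (exists B : K, forall N : nat,
         \sum_(m : {ffun 'I_n -> 'I_N}) `|power_term c h (fun i => m i)| <= B) /\
      (\sum_(m : {ffun 'I_n -> 'I_N}) power_term c h (fun i => m i))
        @[N --> \oo] --> f (a + h).

(* For K = R this is real analyticity, for K = Cx R complex analyticity, of a
   map on an open set U. *)
Definition analytic_on (K : numFieldType) (n p : nat) (U : set 'cV[K]_n)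
    (F : 'cV[K]_n -> 'cV[K]_p) : Prop :=
  forall a, U a -> forall i, analytic_at (fun z => F z i ord0) a.

(* Main.v *)
Require Import Defs.
From HB Require Import structures.
From mathcomp Require Import all_boot all_order all_algebra.
From mathcomp Require Import complex.
From mathcomp Require Import all_classical all_reals topology normedtype.
From mathcomp Require Import interval_inference sequences.
From mathcomp Require Import ring lra.

(** Write w = (1, z) for a point z, and let <x, y> = Re (x y^* ) be the real
    inner product of the plane.  The Gram entries <w_k, w_l> control
    everything.  For a positive matrix M,
      <(M w)_k, (M w)_l> = \sum_(p, q) M_kp M_lq <w_p, w_q>,
    so nonnegative Gram entries stay nonnegative, and if all the ratios of two
    entries in the same column of M are at most B, then comparing the sums
    term by term shows that the ratio of any two Gram entries of M w is at
    most B ^ 2 ([rdot_mulmx_le]).  Dividing by (M w)_1 divides each Gram entry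
    by <(M w)_1, (M w)_1>, which is itself a Gram entry of M w: hence the Gram
    entries of the image lie in [B ^ -2, B ^ 2] as soon as those of z are
    nonnegative ([induced_map_gram]).  With one B for the finite family, take
      U = { z | 0 < <w_k, w_l> < B ^ 2 + 1 for all k, l }.
    The image of U lies in a closed set contained in U, which is the strict
    inclusion.  U is open; the diagonal entries <w_k, w_k> bound it; the entries
    <w_k, w_1> = Re w_k put it in C_+; and it is star-shaped about (1, ..., 1)
    ([to_one_gram_domain]), hence connected.

    Real points with positive coordinates have nonnegative Gram entries, so the
    induced map sends the whole of R_+, a fortiori V = Re U, into the real
    points of that same closed set, and these belong to V.  V is open because
    taking real parts is an open map.

    Analyticity: in coordinates the induced map is a quotient P / D of affine
    forms.  Comparing coefficients in D * (\sum_m c_m h^m) = P gives a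
    recursion that defines the c_m.  Summing this recursion over a finite box
    of multi-indices, with absolute values, bounds the absolute partial sums
    ([box_norm_bound]); without them it shows that the partial sum over the box
    is P / D up to a boundary term, which tends to 0 geometrically because the
    bound also holds at 2 h ([analytic_at_div_affine]). *)

Set Implicit Arguments.
Unset Strict Implicit.
Unset Printing Implicit Defensive.

Import Order.TTheory GRing.Theory Num.Theory.
Import numFieldNormedType.Exports.

Local Open Scope classical_set_scope.
Local Open Scope ring_scope.

(** * Shifting multi-indices inside a box *)

Definition incr (n : nat) (i : 'I_n) (m : 'I_n -> nat) : 'I_n -> nat :=
  fun j => ((j == i) + m j)%N.

Definition decr (n : nat) (i : 'I_n) (m : 'I_n -> nat) : 'I_n -> nat :=
  fun j => (m j - (j == i))%N.

Lemma incrK (n : nat) (i : 'I_n) : cancel (incr i) (decr i).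
Proof. by move=> m; apply/funext => j; rewrite /incr /decr addKn. Qed.

Lemma decrK (n : nat) (i : 'I_n) (m : 'I_n -> nat) :
  (0 < m i)%N -> incr i (decr i m) = m.
Proof.
move=> mi; apply/funext => j; rewrite /incr /decr subnKC //.
by case: eqP => // ->.
Qed.

Lemma sum_decr (n : nat) (i : 'I_n) (m : 'I_n -> nat) :
  (0 < m i)%N -> (\sum_j m j = (\sum_j decr i m j).+1)%N.
Proof.
move=> mi; rewrite -[in LHS](decrK mi) /incr big_split /=.
by rewrite -big_mkcond /= big_pred1_eq.
Qed.

(** Raising the i-th exponent is a bijection from the part of the box where it
    stays inside onto the part where the i-th exponent is positive.  This is
    how multiplication by the i-th variable acts on box sums. *)
Lemma box_shift (V : nmodType) (n N : nat) (i : 'I_n) (F : ('I_n -> nat) -> V) :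
  \sum_(m : {ffun 'I_n -> 'I_N} | (0 < m i)%N) F (fun j => m j) =
  \sum_(m : {ffun 'I_n -> 'I_N} | ((m i).+1 < N)%N) F (incr i (fun j => m j)).
Proof.
case: N => [|N]; first by rewrite !big_pred0 // => m; case: (m i).
pose up (m : {ffun 'I_n -> 'I_N.+1}) : {ffun 'I_n -> 'I_N.+1} :=
  [ffun j => inord (incr i (fun j => m j) j)].
pose dn (m : {ffun 'I_n -> 'I_N.+1}) : {ffun 'I_n -> 'I_N.+1} :=
  [ffun j => inord (decr i (fun j => m j) j)].
have dnE (m : {ffun 'I_n -> 'I_N.+1}) : (fun j => dn m j : nat) = decr i (fun j => m j).
  apply/funext => j; rewrite ffunE inordK //.
  by rewrite (leq_ltn_trans (leq_subr _ _)).
have upE (m : {ffun 'I_n -> 'I_N.+1}) : ((m i).+1 < N.+1)%N ->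
    (fun j => up m j : nat) = incr i (fun j => m j).
  move=> mi; apply/funext => j; rewrite ffunE inordK // /incr.
  by have [->|_] := eqVneq j i; rewrite ?add1n ?add0n.
(* On the boundary face [inord] overflows to 0, so [up m] has a positive
   i-th exponent only when [m] is off that face. *)
have up_gt0 (m : {ffun 'I_n -> 'I_N.+1}) : (0 < up m i)%N -> ((m i).+1 < N.+1)%N.
  by rewrite ffunE /inord val_insubd /incr eqxx add1n; case: ifP.
rewrite (reindex_onto up dn) => [|m mi].
  apply: eq_big => [m|m /andP[/up_gt0 mi _]]; last by rewrite upE.
  apply/idP/idP => [/andP[/up_gt0]//|mi].
  have /(congr1 (fun f => f i)) /= -> := upE _ mi.
  rewrite /incr eqxx add1n /=; apply/eqP/ffunP => j; apply: val_inj.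
  have /(congr1 (fun f => f j)) /= -> := dnE (up m).
  by rewrite (upE _ mi) incrK.
apply/ffunP => j; apply: val_inj; rewrite ffunE /= dnE.
by rewrite (@decrK _ i (fun j => m j)) // inordK.
Qed.

(** * Power series of a quotient by an affine form *)

(** Coefficients of the quotient of [\sum_m p m h^m] by
    [D0 + \sum_i d i h_i], obtained by solving [quotient_coefE] for the
    coefficient at [m].  The argument [k] is fuel for the total degree of [m]. *)
Fixpoint quotient_coef_rec (K : fieldType) (n : nat) (p : ('I_n -> nat) -> K)
    (D0 : K) (d : 'I_n -> K) (k : nat) (m : 'I_n -> nat) : K :=
  D0^-1 * (p m - if k is k'.+1 then
    \sum_(i | (0 < m i)%N) d i * quotient_coef_rec p D0 d k' (decr i m) else 0).

Definition quotient_coef (K : fieldType) (n : nat) (p : ('I_n -> nat) -> K)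
    (D0 : K) (d : 'I_n -> K) (m : 'I_n -> nat) : K :=
  quotient_coef_rec p D0 d (\sum_j m j) m.

Lemma quotient_coefE (K : fieldType) (n : nat) (p : ('I_n -> nat) -> K)
    (D0 : K) (d : 'I_n -> K) (m : 'I_n -> nat) : D0 != 0 ->
  D0 * quotient_coef p D0 d m +
    \sum_(i | (0 < m i)%N) d i * quotient_coef p D0 d (decr i m) = p m.
Proof.
move=> D0_neq0; rewrite {1}/quotient_coef.
case mk : (\sum_j m j)%N => [|k] /=; rewrite mulVKf ?subr0 //.
  rewrite big_pred0 ?addr0 // => i; apply/negbTE; rewrite -leqNgt leqn0.
  by have /eqP := mk; rewrite sum_nat_eq0 => /forallP/(_ i).
rewrite [X in _ + X = _](_ : _ =
  \sum_(i | (0 < m i)%N) d i * quotient_coef_rec p D0 d k (decr i m)).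
  by rewrite subrK.
apply: eq_bigr => i mi; congr (_ * quotient_coef_rec _ _ _ _ _).
by apply: succn_inj; rewrite -(sum_decr mi).
Qed.

Lemma power_term_incr (K : comPzRingType) (n : nat) (c : ('I_n -> nat) -> K)
    (h : 'cV[K]_n) (i : 'I_n) (m : 'I_n -> nat) :
  power_term c h (incr i m) =
  h i ord0 * power_term (fun m => c (incr i m)) h m.
Proof.
rewrite /power_term mulrCA; congr (_ * _); rewrite /incr.
under eq_bigr do rewrite exprD.
rewrite big_split /=; congr (_ * _).
rewrite (bigD1 i) //= eqxx expr1 big1 ?mulr1 // => j /negbTE ->.
by rewrite expr0.
Qed.

(** The product of a truncated series by the affine form.  Terms on the face
    [(m i).+1 = N] are missing from the i-th sum, as multiplying them by the
    i-th variable leaves the box. *)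
Lemma box_sum_affine (K : comPzRingType) (n N : nat)
    (c p : ('I_n -> nat) -> K) (D0 : K) (d : 'I_n -> K) (h : 'cV[K]_n) :
  (forall m, D0 * c m + \sum_(i | (0 < m i)%N) d i * c (decr i m) = p m) ->
  \sum_(m : {ffun 'I_n -> 'I_N}) power_term p h (fun j => m j) =
  D0 * \sum_(m : {ffun 'I_n -> 'I_N}) power_term c h (fun j => m j) +
  \sum_i d i * h i ord0 * \sum_(m : {ffun 'I_n -> 'I_N} | ((m i).+1 < N)%N)
    power_term c h (fun j => m j).
Proof.
move=> cE.
transitivity (\sum_(m : {ffun 'I_n -> 'I_N})
   (D0 * power_term c h (fun j => m j) +
    \sum_(i | (0 < m i)%N)
      d i * power_term (fun m => c (decr i m)) h (fun j => m j))).
  apply: eq_bigr => m _; rewrite {1}/power_term -cE mulrDl -mulrA; congr (_ + _).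
  by rewrite mulr_suml; apply: eq_bigr => i _; rewrite -mulrA.
rewrite big_split /= -mulr_sumr; congr (_ + _).
rewrite (exchange_big_dep xpredT) //=; apply: eq_bigr => i _.
rewrite -mulr_sumr -mulrA; congr (_ * _).
rewrite (@box_shift _ _ _ i (fun m => power_term (fun m => c (decr i m)) h m)).
rewrite mulr_sumr; apply: eq_bigr => m _; rewrite power_term_incr.
by congr (_ * _); rewrite /power_term incrK.
Qed.

Lemma norm_power_term (K : numFieldType) (n : nat) (c : ('I_n -> nat) -> K)
    (h : 'cV[K]_n) (m : 'I_n -> nat) :
  `|power_term c h m| = power_term (fun m => `|c m|) (map_mx Num.norm h) m.
Proof.
rewrite /power_term normrM normr_prod; congr (_ * _).
by apply: eq_bigr => i _; rewrite normrX mxE.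
Qed.

(** The triangle inequality makes the norms of the [c m] a subsolution of the
    same recursion with [`|D0|] and [- `|d i|] in place of [D0] and [d i], so
    that [box_sum_affine] applies again, now with terms of constant sign. *)
Lemma box_norm_bound (K : numFieldType) (n N : nat) (c p : ('I_n -> nat) -> K)
    (D0 : K) (d : 'I_n -> K) (h : 'cV[K]_n) :
  (forall m, D0 * c m + \sum_(i | (0 < m i)%N) d i * c (decr i m) = p m) ->
  (`|D0| - \sum_i `|d i| * `|h i ord0|) *
    \sum_(m : {ffun 'I_n -> 'I_N}) `|power_term c h (fun j => m j)| <=
  \sum_(m : {ffun 'I_n -> 'I_N}) `|power_term p h (fun j => m j)|.
Proof.
move=> cE.
pose p' m := `|D0| * `|c m| +
  \sum_(i | (0 < m i)%N) - `|d i| * `|c (decr i m)|.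
have p'_le m : p' m <= `|p m|.
  rewrite /p' -cE -normrM; under eq_bigr do rewrite mulNr.
  rewrite sumrN lerBlDr; set s := \sum_(i | _) d i * _.
  rewrite -{1}(addrK s (D0 * c m)) (le_trans (ler_normB _ _)) // lerD2l.
  by rewrite (le_trans (ler_norm_sum _ _ _)) // ler_sum // => i _; rewrite normrM.
rewrite (_ : \sum_(m : {ffun 'I_n -> 'I_N}) `|power_term c h (fun j => m j)| =
  \sum_(m : {ffun 'I_n -> 'I_N})
    power_term (fun m => `|c m|) (map_mx Num.norm h) (fun j => m j)); last first.
  by apply: eq_bigr => m _; rewrite norm_power_term.
apply: (@le_trans _ _ (\sum_(m : {ffun 'I_n -> 'I_N})
    power_term p' (map_mx Num.norm h) (fun j => m j))); last first.
  apply: ler_sum => m _; rewrite norm_power_term /power_term ler_wpM2r //.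
  by apply: prodr_ge0 => i _; rewrite exprn_ge0 // mxE.
rewrite (box_sum_affine _ _ (fun m => erefl (p' m))) mulrBl lerD2l.
rewrite mulr_suml -sumrN ler_sum // => i _; rewrite mxE !mulNr lerN2.
rewrite ler_wpM2l ?mulr_ge0 // big_mkcond ler_sum // => m _.
by case: ifP => // _; rewrite -norm_power_term.
Qed.

(** A term with a large exponent is small compared with the same term at
    [2 *: h]. *)
Lemma power_term_double (K : numFieldType) (n : nat) (c : ('I_n -> nat) -> K)
    (h : 'cV[K]_n) (i : 'I_n) (m : 'I_n -> nat) (N : nat) : (N <= m i)%N ->
  `|power_term c h m| <= 2^-1 ^+ N * `|power_term c (2 *: h) m|.
Proof.
move=> Nm; rewrite /power_term.
under [in leRHS]eq_bigr do rewrite mxE exprMn.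
rewrite big_split /= mulrCA [in leRHS]normrM.
rewrite mulrA ler_peMl // (bigD1 i) //= normrM mulrA.
have h2 k : 1 <= `|2 ^+ k| :> K by rewrite ger0_norm ?exprn_ge0// exprn_ege1 // ler1n.
rewrite mulr_ege1 //; last first.
  rewrite normr_prod; apply: (big_ind (fun x => 1 <= x)) => // x y.
  exact: mulr_ege1.
rewrite -(subnK Nm) exprD normrM mulrCA exprVn ger0_norm ?exprn_ge0 //.
rewrite (ger0_norm (exprn_ge0 _ _)) // mulVf ?mulr1 ?expf_neq0 ?pnatr_eq0 //.
by rewrite exprn_ege1 // ler1n.
Qed.

Lemma cvg0_le_mul (K : numFieldType) (u t : nat -> K) (C : K) :
  (forall N, `|u N| <= C * t N) -> t @ \oo --> (0 : K) -> u @ \oo --> (0 : K).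
Proof.
move=> ut t0; apply/cvgr0Pnorm_le => e e0.
have Ct0 : (fun N => C * t N) @ \oo --> (0 : K).
  by rewrite -(mulr0 C); apply: cvgM => //; exact: cvg_cst.
near=> N; rewrite (le_trans (ut N)) //.
have Ct_ge0 : 0 <= C * t N by rewrite (le_trans _ (ut N)).
rewrite -(ger0_norm Ct_ge0).
by near: N; apply: (@cvgr0_norm_le _ _ _ _ _ (fun N => C * t N)).
Unshelve. all: by end_near. Qed.

Lemma entry_le_norm (K : numFieldType) (m n : nat) (x : 'M[K]_(m, n)) i j :
  `|x i j| <= `|x|.
Proof.
rewrite [leRHS]/Num.norm /= mx_normE.
have le_max (F : 'I_m * 'I_n -> {nonneg K}) ij :
    (F ij)%:num <= (\big[Num.max/0%:nng]_ij F ij)%:num.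
  by rewrite num_le; exact: le_bigmax.
exact: (le_max (fun ij => `|x ij.1 ij.2|%:nng) (i, j)).
Qed.

(** The numerator enters only through its box sums, which must be absolutely
    bounded and eventually equal to [P h].  The first hypothesis fails in
    non-archimedean fields, for which the box sums need not converge. *)
Lemma analytic_at_div_affine (K : numFieldType) (n : nat)
    (p : ('I_n -> nat) -> K) (P : 'cV[K]_n -> K) (D0 : K) (d : 'I_n -> K)
    (f : 'cV[K]_n -> K) (a : 'cV[K]_n) :
  (fun N => 2^-1 ^+ N) @ \oo --> (0 : K) -> D0 != 0 ->
  (forall h, exists Q, forall N : nat,
    \sum_(m : {ffun 'I_n -> 'I_N}) `|power_term p h (fun j => m j)| <= Q) ->
  (forall h, \forall N \near \oo,
    \sum_(m : {ffun 'I_n -> 'I_N}) power_term p h (fun j => m j) = P h) ->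
  (forall h, f (a + h) = P h / (D0 + \sum_i d i * h i ord0)) ->
  analytic_at f a.
Proof.
move=> half0 D0_neq0 p_bound p_sum fE.
pose s := \sum_i `|d i|.
have s_ge0 : 0 <= s by apply: sumr_ge0.
(* This radius gives \sum_i `|d i| * `|h i| <= `|D0| / 2 even for vectors of
   norm 2 * r, so that both h and 2 *: h are covered. *)
pose r := `|D0| / (4 * (s + 1)).
have D0_gt0 : 0 < `|D0| by rewrite normr_gt0.
have s1_gt0 : 0 < s + 1 by rewrite ltr_wpDl.
have r_gt0 : 0 < r by rewrite divr_gt0 // mulr_gt0.
have small (h : 'cV[K]_n) : `|h| < 2 * r -> \sum_i `|d i| * `|h i ord0| <= `|D0| / 2.
  move=> hr; apply: (@le_trans _ _ (s * (2 * r))).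
    rewrite mulr_suml ler_sum // => i _; rewrite ler_wpM2l //.
    by rewrite (le_trans (entry_le_norm _ _ _)) ?ltW.
  rewrite /r (_ : s * _ = (`|D0| / 2) * (s / (s + 1))); last first.
    by field; rewrite gt_eqF.
  have D0_ge0 : 0 <= `|D0| / 2 by rewrite divr_ge0.
  by rewrite ler_piMr // ler_pdivrMr // mul1r lerDl.
pose c := quotient_coef p D0 d.
have cE m := @quotient_coefE _ _ p D0 d m D0_neq0.
have c_bound (h : 'cV[K]_n) : `|h| < 2 * r -> exists B, 0 <= B /\ forall N : nat,
    \sum_(m : {ffun 'I_n -> 'I_N}) `|power_term c h (fun j => m j)| <= B.
  move=> /small hs; have [Q Qb] := p_bound h.
  have B0 N : \sum_(m : {ffun 'I_n -> 'I_N}) `|power_term c h (fun j => m j)|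
      <= Q / (`|D0| / 2).
    rewrite ler_pdivlMr ?divr_gt0 // mulrC (le_trans _ (Qb N)) //.
    apply: le_trans (box_norm_bound N h cE).
    rewrite ler_wpM2r ?sumr_ge0 // lerBrDr.
    by rewrite [leRHS](splitr `|D0|) lerD2l.
  exists (Q / (`|D0| / 2)); split => //.
  by rewrite (le_trans _ (B0 0%N)) // sumr_ge0.
exists c; exists r => // h hr.
have h2r : `|h| < 2 * r by rewrite (lt_trans hr) // ltr_pMl // ltr1n.
split; first by have [B [_ ?]] := c_bound h h2r; exists B.
have [B [B_ge0 Bb]] : exists B, 0 <= B /\ forall N : nat,
    \sum_(m : {ffun 'I_n -> 'I_N}) `|power_term c (2 *: h) (fun j => m j)| <= B.
  by apply: c_bound; rewrite normrZ ger0_norm // ltr_pM2l.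
(* The part of the box sum lying on the i-th face. *)
pose E i (N : nat) := \sum_(m : {ffun 'I_n -> 'I_N} | ~~ ((m i).+1 < N)%N)
  power_term c h (fun j => m j).
have E0 i : E i @ \oo --> (0 : K).
  apply: (@cvg0_le_mul _ _ (fun N => 2^-1 ^+ N) (2 * B)) => // N.
  rewrite (le_trans (ler_norm_sum _ _ _)) //.
  apply: (@le_trans _ _ (2 * 2^-1 ^+ N * \sum_(m : {ffun 'I_n -> 'I_N})
      `|power_term c (2 *: h) (fun j => m j)|)); last first.
    by rewrite mulrAC ler_wpM2r ?exprn_ge0 // ler_wpM2l.
  rewrite mulr_sumr big_mkcond ler_sum // => m _.
  case: ifP => [|_]; last by rewrite !mulr_ge0 // exprn_ge0.
  case: N m => [|N] m; first by case: (m i).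
  rewrite -leqNgt ltnS => Nm.
  rewrite exprS mulrA mulfV ?mul1r ?pnatr_eq0 //.
  exact: (@power_term_double _ _ _ _ i).
have D_neq0 : D0 + \sum_i d i * h i ord0 != 0.
  rewrite addrC -[D0]opprK subr_eq0; apply/eqP => /(congr1 Num.norm).
  rewrite normrN => DE.
  have : `|D0| <= `|D0| / 2.
    rewrite -{1}DE (le_trans (ler_norm_sum _ _ _)) //.
    under eq_bigr do rewrite normrM.
    exact: (small _ h2r).
  by rewrite lt_geF // ltr_pdivrMr // ltr_pMr // ltr1n.
rewrite fE.
have : (fun N => P h / (D0 + \sum_i d i * h i ord0) +
    (\sum_i d i * h i ord0 * E i N) / (D0 + \sum_i d i * h i ord0)) @ \oo -->
    P h / (D0 + \sum_i d i * h i ord0).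
  rewrite -[X in _ --> X]addr0; apply: cvgD; first exact: cvg_cst.
  rewrite -[X in _ --> X](mul0r (D0 + \sum_i d i * h i ord0)^-1).
  apply: cvgM; last exact: cvg_cst.
  rewrite [X in _ --> X](_ : 0 = \sum_(i < n) 0); last by rewrite big1.
  apply: (@cvg_big K) => [|i _]; first exact: add_continuous.
  by rewrite -(mulr0 (d i * h i ord0)); apply: cvgM; [exact: cvg_cst|exact: E0].
apply: cvg_trans; apply: near_eq_cvg; near=> N.
have PE : \sum_(m : {ffun 'I_n -> 'I_N}) power_term p h (fun j => m j) = P h.
  by near: N; exact: p_sum.
rewrite -mulrDl -PE (box_sum_affine N h cE) -/c -addrA -big_split /=.
apply: (mulIf D_neq0); rewrite divfK // mulrDr mulrC; congr (_ + _).
rewrite mulr_sumr; apply: eq_bigr => i _.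
rewrite -mulrDr mulrC; congr (_ * _); rewrite /E.
by rewrite [RHS](bigID (fun m : {ffun 'I_n -> 'I_N} => (m i).+1 < N)%N).
Unshelve. all: by end_near. Qed.

(** * Analyticity of the induced map *)

(** The coefficient function of the polynomial [\sum_j k j h^(mu j)]. *)
Definition monomial_sum_coef (K : pzRingType) (n : nat) (J : finType)
    (k : J -> K) (mu : J -> 'I_n -> nat) (m : 'I_n -> nat) : K :=
  \sum_j k j *+ [forall i, m i == mu j i].

(** At most one multi-index of the box equals [mu]: exactly one if [mu] fits. *)
Lemma box_pick (V : nmodType) (n N : nat) (mu : 'I_n -> nat)
    (F : ('I_n -> nat) -> V) :
  \sum_(m : {ffun 'I_n -> 'I_N}) F (fun i => m i) *+ [forall i, m i == mu i :> nat] =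
  F mu *+ [forall i, (mu i < N)%N].
Proof.
case: forallP => [mu_lt|mu_ge].
  pose m0 : {ffun 'I_n -> 'I_N} := [ffun i => Ordinal (mu_lt i)].
  have m0E : (fun i => m0 i : nat) = mu by apply/funext => i; rewrite ffunE.
  rewrite (bigD1 m0) //= [X in _ + X]big1 => [|m m_neq].
    rewrite addr0 m0E; congr (_ *+ _); case: forallP => // -[] i.
    by have /(congr1 (fun f => f i)) /= -> := m0E.
  case: forallP => //= mE; case/eqP: m_neq; apply/ffunP => i; apply: val_inj.
  by rewrite ffunE /= (eqP (mE i)).
rewrite big1 // => m _; case: forallP => // mE; case: mu_ge => i.
by rewrite -(eqP (mE i)).
Qed.

Lemma box_sum_monomials (K : comPzRingType) (n N : nat) (J : finType)
    (k : J -> K) (mu : J -> 'I_n -> nat) (h : 'cV[K]_n) :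
  \sum_(m : {ffun 'I_n -> 'I_N})
    power_term (monomial_sum_coef k mu) h (fun i => m i) =
  \sum_j (k j * \prod_i h i ord0 ^+ mu j i) *+ [forall i, (mu j i < N)%N].
Proof.
under eq_bigr do rewrite /power_term /monomial_sum_coef mulr_suml.
rewrite exchange_big /=; apply: eq_bigr => j _.
rewrite -(@box_pick _ n N (mu j) (fun m => k j * \prod_i h i ord0 ^+ m i)).
by apply: eq_bigr => m _; rewrite mulrnAl.
Qed.

Lemma box_norm_monomials (K : numFieldType) (n N : nat) (J : finType)
    (k : J -> K) (mu : J -> 'I_n -> nat) (h : 'cV[K]_n) :
  \sum_(m : {ffun 'I_n -> 'I_N})
    `|power_term (monomial_sum_coef k mu) h (fun i => m i)| <=
  \sum_j `|k j * \prod_i h i ord0 ^+ mu j i|.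
Proof.
apply: (@le_trans _ _ (\sum_(m : {ffun 'I_n -> 'I_N}) power_term
  (monomial_sum_coef (fun j => `|k j|) mu) (map_mx Num.norm h) (fun i => m i))).
  apply: ler_sum => m _; rewrite norm_power_term /power_term ler_wpM2r //.
    by apply: prodr_ge0 => i _; rewrite exprn_ge0 // mxE.
  rewrite (le_trans (ler_norm_sum _ _ _)) // ler_sum // => j _.
  by rewrite normrMn.
rewrite box_sum_monomials; apply: ler_sum => j _.
rewrite normrM normr_prod.
under eq_bigr do rewrite mxE -normrX.
by case: [forall i, _] => //; rewrite mulr0n mulr_ge0 // prodr_ge0.
Qed.

Lemma analytic_at_affine_quotient (K : numFieldType) (n : nat)
    (P0 D0 : K) (b d : 'I_n -> K) (f : 'cV[K]_n -> K) (a : 'cV[K]_n) :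
  (fun N => 2^-1 ^+ N) @ \oo --> (0 : K) -> D0 != 0 ->
  (forall h, f (a + h) =
    (P0 + \sum_i b i * h i ord0) / (D0 + \sum_i d i * h i ord0)) ->
  analytic_at f a.
Proof.
move=> half0 D0_neq0 fE.
(* One monomial for the constant term and one for each variable. *)
pose k (j : 'I_1 + 'I_n) := match j with inl _ => P0 | inr i => b i end.
pose mu (j : 'I_1 + 'I_n) (i' : 'I_n) : nat :=
  match j with inl _ => 0 | inr i => i' == i end.
apply: (@analytic_at_div_affine _ _ (monomial_sum_coef k mu) _ D0 d f a _ _ _ _ fE)
  => // h.
  by exists (\sum_j `|k j * \prod_i h i ord0 ^+ mu j i|) => N;
    exact: box_norm_monomials.
exists 2 => // N /= N2; rewrite box_sum_monomials big_sumType big_ord1 /=.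
have N_gt0 : (0 < N)%N by rewrite (leq_trans _ N2).
rewrite (_ : [forall i, _] = true); last exact/forallP.
rewrite [\prod_i _]big1 // mulr1.
congr (_ + _); apply: eq_bigr => i _.
rewrite (_ : [forall i', _] = true); last first.
  by apply/forallP => i'; rewrite (leq_ltn_trans (leq_b1 _)).
rewrite (bigD1 i) //= eqxx expr1 big1 ?mulr1 // => j /negbTE ->.
by rewrite expr0.
Qed.

Lemma add_one0 (K : pzRingType) (n : nat) (z : 'cV[K]_n) :
  add_one z ord0 ord0 = 1.
Proof.
rewrite /add_one (_ : @ord0 n = @lshift 1 n ord0); last exact: val_inj.
by rewrite [LHS](@col_mxEu K 1 n 1) mxE eqxx.
Qed.

Lemma add_one_lift (K : pzRingType) (n : nat) (z : 'cV[K]_n) (i : 'I_n) :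
  add_one z (lift ord0 i) ord0 = z i ord0.
Proof.
rewrite /add_one (_ : lift (@ord0 n) i = rshift 1 i); last exact: val_inj.
exact: (@col_mxEd K 1 n 1).
Qed.

Lemma mul_add_one (K : pzRingType) (n : nat) (M : 'M[K]_n.+1) (z : 'cV[K]_n) k :
  (M *m add_one z) k ord0 = M k ord0 + \sum_i M k (lift ord0 i) * z i ord0.
Proof.
rewrite mxE big_ord_recl add_one0 mulr1; congr (_ + _).
by apply: eq_bigr => i _; rewrite add_one_lift.
Qed.

Lemma induced_mapE (K : fieldType) (n : nat) (M : 'M[K]_n.+1) (z : 'cV[K]_n) i :
  induced_map M z i ord0 =
  (M *m add_one z) (lift ord0 i) ord0 / (M *m add_one z) ord0 ord0.
Proof.
rewrite /induced_map /drop_first /projective_map [dsubmx _ _ _]mxE mxE mulrC.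
by congr (_ * _); congr (_ _ _); apply: val_inj.
Qed.

Lemma add_one_induced_map (K : fieldType) (n : nat) (M : 'M[K]_n.+1)
    (z : 'cV[K]_n) k : (M *m add_one z) ord0 ord0 != 0 ->
  add_one (induced_map M z) k ord0 =
  (M *m add_one z) k ord0 / (M *m add_one z) ord0 ord0.
Proof.
move=> M0; have [i ->|->] := unliftP ord0 k; last by rewrite add_one0 divff.
by rewrite add_one_lift induced_mapE.
Qed.

Lemma induced_map_analytic (K : numFieldType) (n : nat) (M : 'M[K]_n.+1)
    (U : set 'cV[K]_n) :
  (fun N => 2^-1 ^+ N) @ \oo --> (0 : K) ->
  (forall z, U z -> (M *m add_one z) ord0 ord0 != 0) ->
  analytic_on U (induced_map M).
Proof.
move=> half0 M_neq0 a Ua i.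
apply: (@analytic_at_affine_quotient _ _ ((M *m add_one a) (lift ord0 i) ord0)
  ((M *m add_one a) ord0 ord0) (fun j => M (lift ord0 i) (lift ord0 j))
  (fun j => M ord0 (lift ord0 j))) => // [|h]; first exact: M_neq0.
rewrite induced_mapE !mul_add_one -!addrA -!big_split /=.
by congr ((_ + _) / (_ + _)); apply: eq_bigr => j _; rewrite mxE mulrDr.
Qed.

(** * The real inner product of complex numbers and positive matrices *)

(** [Re (x * y^* )], the Euclidean inner product of the plane. *)
Definition rdot (R : realType) (x y : Cx R) : R :=
  @complex.Re R x * @complex.Re R y + @complex.Im R x * @complex.Im R y.

Lemma rdot1r (R : realType) (x : Cx R) : rdot x 1 = @complex.Re R x.
Proof. by rewrite /rdot /= mulr1 mulr0 addr0. Qed.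

Lemma rdot_sum (R : realType) (I J : finType) (a : I -> R) (b : J -> R)
    (w : I -> Cx R) (v : J -> Cx R) :
  rdot (\sum_i real_complex R (a i) * w i : Cx R)
       (\sum_j real_complex R (b j) * v j : Cx R) =
  \sum_i \sum_j a i * b j * rdot (w i) (v j).
Proof.
have scalE (c : R) (z : Cx R) : @complex.Re R (real_complex R c * z : Cx R) =
    c * @complex.Re R z /\ @complex.Im R (real_complex R c * z : Cx R) =
    c * @complex.Im R z.
  by case: z => x y /=; rewrite !mul0r subr0 addr0.
have sumE (H : finType) (c : H -> R) (z : H -> Cx R) :
    @complex.Re R (\sum_i real_complex R (c i) * z i : Cx R) =
      \sum_i c i * @complex.Re R (z i) /\
    @complex.Im R (\sum_i real_complex R (c i) * z i : Cx R) =
      \sum_i c i * @complex.Im R (z i).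
  split.
    rewrite (big_morph (@complex.Re R) (id1 := 0) (op1 := +%R)) //.
      by apply: eq_bigr => i _; rewrite (scalE _ _).1.
    by case=> ? ? [].
  rewrite (big_morph (@complex.Im R) (id1 := 0) (op1 := +%R)) //.
    by apply: eq_bigr => i _; rewrite (scalE _ _).2.
  by case=> ? ? [].
rewrite /rdot !(sumE _ _ _).1 !(sumE _ _ _).2 !big_distrlr /= -big_split /=.
apply: eq_bigr => i _; rewrite -big_split /=; apply: eq_bigr => j _.
by ring.
Qed.

(** Dividing by [u] is a similarity of the plane of ratio [`|u|^-1]. *)
Lemma rdot_div (R : realType) (x y u : Cx R) :
  u != 0 -> rdot (x / u) (y / u) = rdot x y / rdot u u.
Proof.
case: x y u => [a b] [c d] [e f] u0.
have : e ^+ 2 + f ^+ 2 != 0.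
  apply: contraNneq u0 => /eqP; rewrite paddr_eq0 ?sqr_ge0 // !sqrf_eq0.
  by case/andP => /eqP -> /eqP ->.
rewrite /rdot /=; rewrite !expr2 => n0; field.
exact: n0.
Qed.

Lemma rdot_gt0 (R : realType) (x : Cx R) : (0 < rdot x x) = (x != 0).
Proof.
case: x => a b; rewrite /rdot /= -!expr2 lt0r.
rewrite addr_ge0 ?sqr_ge0 // andbT paddr_eq0 ?sqr_ge0 // !sqrf_eq0.
by rewrite [in RHS]eq_complex.
Qed.

Lemma rdot_mulmx (R : realType) (n : nat) (M : 'M[R]_n) (w : 'cV[Cx R]_n) k l :
  rdot ((complexify_mx M *m w) k ord0) ((complexify_mx M *m w) l ord0) =
  \sum_p \sum_q M k p * M l q * rdot (w p ord0) (w q ord0).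
Proof.
rewrite -rdot_sum; congr rdot; rewrite mxE; apply: eq_bigr => p _;
  by rewrite mxE.
Qed.

(** Both sides are combinations of the same nonnegative inner products, and
    [M k p * M l q <= B ^+ 2 * (M k' p * M l' q)] coefficient by coefficient. *)
Lemma rdot_mulmx_le (R : realType) (n : nat) (M : 'M[R]_n) (B : R)
    (w : 'cV[Cx R]_n) :
  positive_mx M -> (forall k l p, M k p <= B * M l p) ->
  (forall p q, 0 <= rdot (w p ord0) (w q ord0)) ->
  forall k l k' l',
  rdot ((complexify_mx M *m w) k ord0) ((complexify_mx M *m w) l ord0) <=
  B ^+ 2 *
  rdot ((complexify_mx M *m w) k' ord0) ((complexify_mx M *m w) l' ord0).
Proof.
move=> M_gt0 MB w_ge0 k l k' l'; rewrite !rdot_mulmx mulr_sumr.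
apply: ler_sum => p _; rewrite mulr_sumr; apply: ler_sum => q _.
rewrite mulrA ler_wpM2r // expr2 mulrACA ler_pM //; exact: ltW.
Qed.

(** All the terms of the expansion are nonnegative and the diagonal term of
    index [p] is positive: strict positivity comes from the diagonal. *)
Lemma rdot_mulmx_gt0 (R : realType) (n : nat) (M : 'M[R]_n) (w : 'cV[Cx R]_n) p :
  positive_mx M -> (forall p q, 0 <= rdot (w p ord0) (w q ord0)) ->
  w p ord0 != 0 -> forall k l,
  0 < rdot ((complexify_mx M *m w) k ord0) ((complexify_mx M *m w) l ord0).
Proof.
move=> M_gt0 w_ge0 wp k l; rewrite rdot_mulmx.
rewrite (bigD1 p) //= (bigD1 p) //= -addrA ltr_wpDr //.
  rewrite addr_ge0 // sumr_ge0 // => i _; last rewrite sumr_ge0 // => j _.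
    by rewrite !mulr_ge0 // ltW.
  by rewrite !mulr_ge0 // ltW.
by rewrite !mulr_gt0 // rdot_gt0.
Qed.

(** * The invariant domain *)

Definition gram (R : realType) (n : nat) (z : 'cV[Cx R]_n) (k l : 'I_n.+1) : R :=
  rdot (add_one z k ord0) (add_one z l ord0).

Definition gram_domain (R : realType) (n : nat) (L : R) : set 'cV[Cx R]_n :=
  [set z | forall k l, 0 < gram z k l < L].

Definition gram_range (R : realType) (n : nat) (B : R) : set 'cV[Cx R]_n :=
  [set z | forall k l, B ^- 2 <= gram z k l <= B ^+ 2].

(** The contraction: the normalising factor is itself a Gram entry of the image
    vector, so [rdot_mulmx_le] bounds the normalised Gram entries from above and
    from below by constants independent of [z]. *)
Lemma induced_map_gram (R : realType) (n : nat) (M : 'M[R]_n.+1) (B : R)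
    (z : 'cV[Cx R]_n) :
  0 < B -> positive_mx M -> (forall k l p, M k p <= B * M l p) ->
  (forall k l, 0 <= gram z k l) ->
  (complexify_mx M *m add_one z) ord0 ord0 != 0 /\
  gram_range B (induced_map (complexify_mx M) z).
Proof.
move=> B_gt0 M_gt0 MB z_ge0.
have w0 : add_one z ord0 ord0 != 0 by rewrite add_one0 oner_neq0.
have Mw_gt0 := rdot_mulmx_gt0 M_gt0 z_ge0 w0 ord0 ord0.
have Mw0 : (complexify_mx M *m add_one z) ord0 ord0 != 0 by rewrite -rdot_gt0.
split=> // k l; rewrite /gram !add_one_induced_map // rdot_div //.
have B2_gt0 : 0 < B ^+ 2 by rewrite exprn_gt0.
have le_MB := rdot_mulmx_le M_gt0 MB z_ge0.
by rewrite ler_pdivlMr // ler_pdivrMr // ler_pdivrMl // !le_MB.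
Qed.

(** * Topology of the invariant domain *)

Lemma normc_ge_parts (R : realType) (z : Cx R) :
  `|@complex.Re R z| <= @complex.Re R `|z| /\
  `|@complex.Im R z| <= @complex.Re R `|z|.
Proof.
rewrite normc_def /= -![in X in X /\ _]sqrtr_sqr -![in X in _ /\ X]sqrtr_sqr.
by split; rewrite ler_wsqrtr // ?lerDl ?lerDr sqr_ge0.
Qed.

Lemma ltc_Re (R : realType) (x y : Cx R) :
  x < y -> @complex.Re R x < @complex.Re R y.
Proof. by rewrite ltcE => /andP[]. Qed.

Lemma continuous_Re (R : realType) : continuous (@complex.Re R : Cx R -> R).
Proof.
move=> z; apply/(cvgrPdist_lt (FF := nbhs_filter z)) => e e0; apply/nbhs_ballP.
exists (real_complex R e : Cx R) => /=; first by rewrite ltcR.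
move=> y; rewrite -ball_normE /= => /ltc_Re /=; apply: le_lt_trans.
by apply: le_trans (normc_ge_parts _).1; case: (z) (y) => ? ? [].
Qed.

Lemma continuous_Im (R : realType) : continuous (@complex.Im R : Cx R -> R).
Proof.
move=> z; apply/(cvgrPdist_lt (FF := nbhs_filter z)) => e e0; apply/nbhs_ballP.
exists (real_complex R e : Cx R) => /=; first by rewrite ltcR.
move=> y; rewrite -ball_normE /= => /ltc_Re /=; apply: le_lt_trans.
by apply: le_trans (normc_ge_parts _).2; case: (z) (y) => ? ? [].
Qed.

Lemma continuous_real_complex (R : realType) :
  continuous (real_complex R : R -> Cx R).
Proof.
move=> x; apply/cvgrPdist_lt => e; rewrite ltcE /= => /andP[/eqP e_im e_re].
apply/nbhs_ballP; exists (@complex.Re R e) => //= y /=.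
rewrite -(@rmorphB _ _ (real_complex R)) normc_def ltcE /= e_im eqxx /=.
by rewrite expr0n /= addr0 sqrtr_sqr.
Qed.

Lemma continuous_mx (T : topologicalType) (K : numFieldType) (m n : nat)
    (f : T -> 'M[K]_(m, n)) :
  (forall i j, continuous (fun x => f x i j)) -> continuous f.
Proof.
move=> fc x; apply/cvg_ballP => e e0.
have : \forall y \near x, forall ij : 'I_m * 'I_n,
    ball (f x ij.1 ij.2) e (f y ij.1 ij.2).
  by apply: filter_forall => ij; move: e e0; apply/cvg_ballP; exact: fc.
by apply: filterS => y fy; split => // i j; exact: (fy (i, j)).
Qed.

Lemma half_expn_cvg (R : realType) : (fun N => 2^-1 ^+ N) @ \oo --> (0 : R).
Proof. by apply: cvg_expr; rewrite ger0_norm // invf_lt1 // ltr1n. Qed.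

Lemma half_expn_cvgC (R : realType) : (fun N => 2^-1 ^+ N) @ \oo --> (0 : Cx R).
Proof.
rewrite (_ : (fun N => _) = (real_complex R : R -> Cx R) \o (fun N => 2^-1 ^+ N)).
  apply: (@cvg_comp _ _ _ _ _ _ (nbhs (0 : R))); first exact: half_expn_cvg.
  exact: continuous_real_complex.
by apply/funext => N /=; rewrite rmorphXn fmorphV rmorph_nat.
Qed.

Lemma continuous_gram (R : realType) (n : nat) (k l : 'I_n.+1) :
  continuous (fun z : 'cV[Cx R]_n => gram z k l).
Proof.
have addc (i : 'I_n.+1) : continuous (fun z : 'cV[Cx R]_n => add_one z i ord0).
  have [j ->|->] := unliftP ord0 i.
    by under eq_fun do rewrite add_one_lift; exact: coord_continuous.
  by under eq_fun do rewrite add_one0; exact: cst_continuous.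
have Rec i : continuous (fun z : 'cV[Cx R]_n => @complex.Re R (add_one z i ord0)).
  by move=> z; apply: (continuous_comp (addc i z)); exact: continuous_Re.
have Imc i : continuous (fun z : 'cV[Cx R]_n => @complex.Im R (add_one z i ord0)).
  by move=> z; apply: (continuous_comp (addc i z)); exact: continuous_Im.
move=> z; exact: (@cvgD R _ _ _ _ _ _ _ _
  (cvgM (Rec k z) (Rec l z)) (cvgM (Imc k z) (Imc l z))).
Qed.

Lemma open_gram_domain (R : realType) (n : nat) (L : R) :
  open (@gram_domain R n L).
Proof.
rewrite openE => z zU; have nbhsF : Filter (nbhs z) := nbhs_filter z.
have : \forall y \near z, forall kl : 'I_n.+1 * 'I_n.+1,
    0 < gram y kl.1 kl.2 < L.
  apply: (filter_forall nbhsF) => -[k l] /=.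
  have /andP[g0 gL] := zU k l.
  have gc A : open A -> A (gram z k l) -> \forall y \near z, A (gram y k l).
    by move=> A_open Az; apply: (@continuous_gram R n k l z); exact: open_nbhs_nbhs.
  have := @filterI _ _ nbhsF _ _ (gc _ (@open_gt R 0) g0) (gc _ (@open_lt R L) gL).
  by apply: filterS => y /= [-> ->].
by apply: filterS => y yU k l; exact: (yU (k, l)).
Qed.

Lemma closed_gram_range (R : realType) (n : nat) (B : R) :
  closed (@gram_range R n B).
Proof.
rewrite (_ : gram_range B = \bigcap_(kl in [set: 'I_n.+1 * 'I_n.+1])
    ((fun z : 'cV[Cx R]_n => gram z kl.1 kl.2) @^-1`
      ([set x | B ^- 2 <= x] `&` [set x | x <= B ^+ 2]))).
  apply: closed_bigI => kl _; apply: closed_comp; last first.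
    by apply: closedI; [exact: closed_ge|exact: closed_le].
  by move=> z _; exact: continuous_gram.
apply/seteqP; split => z zB => [kl _ | k l].
  by have /andP[] := zB kl.1 kl.2.
by have /= [-> ->] := zB (k, l) I.
Qed.

Lemma gram_range_domain (R : realType) (n : nat) (B : R) :
  0 < B -> @gram_range R n B `<=` @gram_domain R n (B ^+ 2 + 1).
Proof.
move=> B0 z zB k l; have /andP[g1 g2] := zB k l.
by rewrite (lt_le_trans _ g1) ?invr_gt0 ?exprn_gt0 // (le_lt_trans g2) // ltrDl.
Qed.

Lemma gram_domain_C_plus (R : realType) (n : nat) (L : R) :
  @gram_domain R n L `<=` @C_plus R n.
Proof.
move=> z zU i; have /andP[+ _] := zU (lift ord0 i) ord0.
by rewrite /gram add_one0 rdot1r add_one_lift.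
Qed.

Lemma bounded_gram_domain (R : realType) (n : nat) (L : R) :
  1 <= L -> bounded_set (@gram_domain R n L).
Proof.
move=> L1; exists (real_complex R L : Cx R); split; first by rewrite complex_real.
move=> x Lx z zU /=; rewrite (le_trans _ (ltW Lx)) //.
have L0 : 0 <= L by rewrite (le_trans _ L1).
have [->|z0] := eqVneq z 0; first by rewrite normr0 ler0c.
have [|[i j] zE] := @mx_norm_neq0 _ _ _ z.
  by apply: contraNneq z0 => /mx_norm_eq0 ->.
rewrite [leLHS]zE (ord1 j) /= normc_def lecR.
have /andP[_] := zU (lift ord0 i) (lift ord0 i).
rewrite /gram add_one_lift /rdot -!expr2 => zL.
rewrite -[leRHS]ger0_norm // -sqrtr_sqr ler_wsqrtr // (le_trans (ltW zL)) //.
by rewrite expr2 ler_peMl.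
Qed.

(** The point at parameter [t] of the segment from [(1, ..., 1)] to [z]. *)
Definition to_one (R : realType) (n : nat) (z : 'cV[Cx R]_n) (t : R) : 'cV[Cx R]_n :=
  \col_i (real_complex R (1 - t) + real_complex R t * z i ord0).

Lemma continuous_to_one (R : realType) (n : nat) (z : 'cV[Cx R]_n) :
  continuous (to_one z).
Proof.
apply: continuous_mx => i j; under eq_fun do rewrite mxE.
move=> t; apply: (@cvgD (Cx R)); last first.
  apply: (@cvgM (Cx R)); last exact: cvg_cst.
  exact: continuous_real_complex.
apply: (@continuous_comp R R (Cx R)); last exact: continuous_real_complex.
by apply: (@cvgB R); [exact: cvg_cst|exact: cvg_id].
Qed.

(** The same interpolation holds for the first coordinate, which is constantly
    1; the cross terms are then real parts, that is, Gram entries of index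
    [ord0]. *)
Lemma gram_to_one (R : realType) (n : nat) (z : 'cV[Cx R]_n) (t : R) k l :
  gram (to_one z t) k l = (1 - t) ^+ 2 +
    t * (1 - t) * (gram z k ord0 + gram z l ord0) + t ^+ 2 * gram z k l.
Proof.
have add_one_to_one j : add_one (to_one z t) j ord0 =
    real_complex R (1 - t) + real_complex R t * add_one z j ord0.
  have [i ->|->] := unliftP ord0 j; first by rewrite !add_one_lift mxE.
  by rewrite !add_one0 mulr1 -rmorphD subrK.
rewrite /gram !add_one_to_one add_one0 !rdot1r.
case: (add_one z k ord0) (add_one z l ord0) => a b [c d].
by rewrite /rdot /=; ring.
Qed.

(** By [gram_to_one], both [gram] and [L - gram] on the segment are combinations
    of positive numbers with weights [(1 - t) ^+ 2], [t * (1 - t)] and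
    [t ^+ 2]; for [L - gram] this uses that the weights, the middle one counted
    twice, add up to 1. *)
Lemma to_one_gram_domain (R : realType) (n : nat) (L : R) (z : 'cV[Cx R]_n) t :
  1 < L -> gram_domain L z -> 0 <= t <= 1 -> gram_domain L (to_one z t).
Proof.
move=> L1 zU /andP[t0 t1] k l.
have comb (c0 c1 c2 : R) : 0 < c0 -> 0 < c1 -> 0 < c2 ->
    0 < (1 - t) ^+ 2 * c0 + t * (1 - t) * c1 + t ^+ 2 * c2.
  move=> c0_gt0 c1_gt0 c2_gt0; have [->|t_neq1] := eqVneq t 1; first by lra.
  have t_lt1 : 0 < 1 - t by rewrite subr_gt0 lt_neqAle t_neq1.
  rewrite -addrA ltr_pwDl //; first by rewrite mulr_gt0 // exprn_gt0.
  by rewrite addr_ge0 // !mulr_ge0 ?sqr_ge0 // ltW.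
have /andP[a0 aL] := zU k ord0; have /andP[b0 bL] := zU l ord0.
have /andP[c0 cL] := zU k l.
rewrite gram_to_one; set a := gram z k ord0 in a0 aL *.
set b := gram z l ord0 in b0 bL *; set c := gram z k l in c0 cL *.
apply/andP; split.
  have := comb 1 (a + b) c ltr01 (addr_gt0 a0 b0) c0; lra.
have := comb (L - 1) ((L - a) + (L - b)) (L - c).
rewrite !subr_gt0 addr_gt0 ?subr_gt0 // => /(_ L1 isT cL); lra.
Qed.

Lemma one_gram_domain (R : realType) (n : nat) (L : R) :
  1 < L -> gram_domain L (const_mx 1 : 'cV[Cx R]_n).
Proof.
move=> L1 k l.
have oneE j : add_one (const_mx 1 : 'cV[Cx R]_n) j ord0 = 1.
  by have [i ->|->] := unliftP ord0 j; rewrite ?add_one_lift ?add_one0 ?mxE.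
by rewrite /gram !oneE rdot1r ltr01.
Qed.

Lemma connected_gram_domain (R : realType) (n : nat) (L : R) :
  1 < L -> connected (@gram_domain R n L).
Proof.
move=> L1.
rewrite (_ : gram_domain L =
  \bigcup_(z in @gram_domain R n L) (to_one z @` `[0, 1]%classic)).
  apply: bigcup_connected.
    exists (const_mx 1) => z zU; exists 0; first by rewrite /= in_itv /= lexx ler01.
    by apply/colP => i; rewrite !mxE subr0 mul0r addr0.
  move=> z zU; apply: connected_continuous_connected.
    exact: segment_connected.
  by apply: continuous_subspaceT; exact: continuous_to_one.
apply/seteqP; split => [z zU|_ [z zU [t t01 <-]]].
  exists z => //; exists 1; first by rewrite /= in_itv /= lexx ler01.
  by apply/colP => i; rewrite !mxE subrr add0r mul1r.
by apply: to_one_gram_domain => //; move: t01; rewrite /= in_itv.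
Qed.

(** * Real points *)

Lemma continuous_complexify_mx (R : realType) (m n : nat) :
  continuous (@complexify_mx R m n).
Proof.
apply: continuous_mx => i j; under eq_fun do rewrite mxE.
move=> x; apply: (@continuous_comp 'M[R]_(m, n) R (Cx R) (fun x => x i j)).
  exact: coord_continuous.
exact: continuous_real_complex.
Qed.

Lemma continuous_Re_mx (R : realType) (m n : nat) : continuous (@Re_mx R m n).
Proof.
apply: continuous_mx => i j; under eq_fun do rewrite mxE.
move=> x; apply: (@continuous_comp 'M[Cx R]_(m, n) (Cx R) R (fun x => x i j)).
  exact: coord_continuous.
exact: continuous_Re.
Qed.

Lemma complexify_mxK (R : realType) (m n : nat) :
  cancel (@complexify_mx R m n) (@Re_mx R m n).
Proof. by move=> x; apply/matrixP => i j; rewrite !mxE. Qed.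

(** Moving the real part of [z] while keeping its imaginary part gives a
    continuous local section of [Re_mx] through [z]. *)
Lemma open_Re_mx (R : realType) (m n : nat) (U : set 'M[Cx R]_(m, n)) :
  open U -> open (@Re_mx R m n @` U).
Proof.
move=> U_open; rewrite openE => _ [z zU <-].
pose lift_at (x : 'M[R]_(m, n)) : 'M[Cx R]_(m, n) :=
  z + complexify_mx (x - Re_mx z).
have lift_cont : continuous lift_at.
  apply: continuous_mx => i j; under eq_fun do rewrite !mxE.
  move=> x; apply: (@cvgD (Cx R) (Cx R) _ _ (nbhs_filter x)); first exact: cst_continuous.
  apply: (@continuous_comp 'M[R]_(m, n) R (Cx R)
    (fun x => x i j - @complex.Re R (z i j))); last exact: continuous_real_complex.
  apply: (@cvgB R R _ _ (nbhs_filter x)); first exact: coord_continuous.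
  exact: cst_continuous.
have liftK x : Re_mx (lift_at x) = x.
  apply/matrixP => i j; rewrite !mxE.
  by case: (z i j) => a b /=; rewrite subrKC.
apply: (@filterS _ _ (nbhs_filter (Re_mx z)) (lift_at @^-1` U)).
  by move=> x xU; exists (lift_at x).
apply: lift_cont; apply: open_nbhs_nbhs; split => //.
by rewrite /lift_at subrr (_ : complexify_mx 0 = 0) ?addr0 //;
  apply/matrixP => i j; rewrite !mxE.
Qed.

Lemma complexify_add_one (R : realType) (n : nat) (x : 'cV[R]_n) :
  add_one (complexify_mx x) = complexify_mx (add_one x).
Proof.
apply/colP => i; rewrite [RHS]mxE.
have [j ->|->] := unliftP ord0 i; first by rewrite !add_one_lift mxE.
by rewrite !add_one0.
Qed.

Lemma complexify_mulmx_add_one (R : realType) (n : nat) (M : 'M[R]_n.+1)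
    (x : 'cV[R]_n) k :
  (complexify_mx M *m add_one (complexify_mx x)) k ord0 =
  real_complex R ((M *m add_one x) k ord0).
Proof.
rewrite complexify_add_one /complexify_mx -(@map_mxM _ _ (real_complex R)).
by rewrite mxE.
Qed.

Lemma complexify_induced_map (R : realType) (n : nat) (M : 'M[R]_n.+1)
    (x : 'cV[R]_n) :
  complexify_mx (induced_map M x) =
  induced_map (complexify_mx M) (complexify_mx x).
Proof.
apply/colP => i; rewrite mxE !induced_mapE !complexify_mulmx_add_one.
by rewrite fmorph_div.
Qed.

Lemma gram_complexify_ge0 (R : realType) (n : nat) (x : 'cV[R]_n) k l :
  R_plus x -> 0 <= gram (complexify_mx x) k l.
Proof.
move=> x_gt0; rewrite /gram complexify_add_one.
rewrite ![complexify_mx _ _ _]mxE /rdot /= mulr0 addr0.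
have w_ge0 j : 0 <= add_one x j ord0.
  have [i ->|->] := unliftP ord0 j; last by rewrite add_one0.
  by rewrite add_one_lift ltW.
by rewrite mulr_ge0.
Qed.

(** A single constant for the whole family, as the bound on the Gram entries,
    and so the domain, must not depend on the matrix. *)
Lemma entry_ratio_bound (R : realType) (I : finType) (n : nat)
    (M : I -> 'M[R]_n) : (forall i, positive_mx (M i)) ->
  exists B : R, 0 < B /\ forall i k l p, M i k p <= B * M i l p.
Proof.
move=> M_gt0.
pose ratio (x : I * 'I_n * 'I_n * 'I_n) :=
  M x.1.1.1 x.1.1.2 x.2 / M x.1.1.1 x.1.2 x.2.
exists (\big[Num.max/1]_x ratio x); split.
  by rewrite (lt_le_trans ltr01) // bigmax_ge_id.
move=> i k l p; rewrite -ler_pdivrMr; last exact: M_gt0.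
exact: (le_bigmax _ ratio (i, k, l, p)).
Qed.

Lemma closure_image_sub (S T : topologicalType) (f : S -> T) (W1 : set S)
    (F W2 : set T) :
  closed F -> (forall x, W1 x -> F (f x)) -> F `<=` W2 ->
  maps_strictly_inside f W1 W2.
Proof.
move=> F_closed fF FW; apply: subset_trans FW.
rewrite [X in _ `<=` X](closure_id F).1 //; apply: closureS => _ [x xW <-].
exact: fF.
Qed.

(** * The common invariant domain of a finite family *)

Theorem corollary2p2 (R : realType) (n : nat) (d_ge2 : (2 <= n.+1)%N)
    (I : finType) (M : I -> 'M[R]_n.+1)
    (M_pos : forall i, positive_mx (M i)) :
  exists U : set 'cV[Cx R]_n,
    [/\ U !=set0, open U, connected U, bounded_set U & U `<=` @C_plus R n] /\
    (forall i, maps_strictly_inside (induced_map (complexify_mx (M i))) U U /\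
               analytic_on U (induced_map (complexify_mx (M i)))) /\
    let V : set 'cV[R]_n := @Re_mx R n 1 @` U in
    [/\ V !=set0, open V, connected V & V `<=` @R_plus R n] /\
    (forall i, maps_strictly_inside (induced_map (M i)) V V /\
               analytic_on V (induced_map (M i))).
Proof.
have [B [B_gt0 MB]] := entry_ratio_bound M_pos.
pose U := @gram_domain R n (B ^+ 2 + 1).
have L_gt1 : 1 < B ^+ 2 + 1 by rewrite ltrDr exprn_gt0.
have U_neq0 : U !=set0 by exists (const_mx 1); exact: one_gram_domain.
have U_open : open U := @open_gram_domain R n _.
have U_conn : connected U := connected_gram_domain L_gt1.
have range_U := @gram_range_domain R n B B_gt0.
have C_map i z : (forall k l, 0 <= gram z k l) ->
    (complexify_mx (M i) *m add_one z) ord0 ord0 != 0 /\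
    gram_range B (induced_map (complexify_mx (M i)) z).
  by apply: induced_map_gram => //; exact: MB.
have U_ge0 z : U z -> forall k l, 0 <= gram z k l.
  by move=> zU k l; have /andP[/ltW] := zU k l.
exists U; split.
  split=> //; first exact: bounded_gram_domain (ltW L_gt1).
  exact: gram_domain_C_plus.
split=> [i|V].
  split; last first.
    apply: induced_map_analytic; first exact: half_expn_cvgC.
    by move=> z zU; have [] := C_map i z (U_ge0 _ zU).
  apply: (closure_image_sub (@closed_gram_range R n B)) => // z zU.
  by have [] := C_map i z (U_ge0 _ zU).
have V_R_plus : V `<=` @R_plus R n.
  by move=> _ [z /gram_domain_C_plus zC <-] i; rewrite mxE.
split.
  split=> //; first by have [z zU] := U_neq0; exists (Re_mx z); exists z.
    exact: open_Re_mx.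
  apply: connected_continuous_connected => //.
  by apply: continuous_subspaceT; exact: continuous_Re_mx.
move=> i; split; last first.
  apply: induced_map_analytic; first exact: half_expn_cvg.
  move=> x xV.
  have [+ _] := C_map i _ (fun k l => gram_complexify_ge0 k l (V_R_plus _ xV)).
  by rewrite complexify_mulmx_add_one; apply: contraNneq => ->.
apply: (@closure_image_sub _ _ _ _ (@complexify_mx R n 1 @^-1` gram_range B)).
- apply: closed_comp; last exact: closed_gram_range.
  by move=> x _; exact: continuous_complexify_mx.
- move=> x xV /=; rewrite complexify_induced_map.
  by have [] := C_map i _ (fun k l => gram_complexify_ge0 k l (V_R_plus _ xV)).
- by move=> x /range_U xU; exists (complexify_mx x) => //; rewrite complexify_mxK.
Qed.
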